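(* Let $\mathcal{H}=\{rrr,rrb\}$. Then, as $n\to\infty$, $h_2(n,\mathcal{H})=\Omega(\sqrt{n\log n})$ and $h_2(n,\mathcal{H})=O(\sqrt{n}\,\log^{3/2}n)$.
   Context: Edge-colorings of the complete graph $K_n$ use colors from $\{r,b,y\}$ (red, blue, yellow); they need not be proper, and not all colors need be used. A pattern is an edge-colored triangle, denoted by the multiset of the colors of its three edges; e.g. $rrr$ is the all-red triangle and $rrb$ is the triangle with two red edges and one blue edge. For a family $\mathcal{H}$ of patterns, $\operatorname{Forb}(n,\mathcal{H})$ is the set of all edge-colorings of $K_n$ with colors from $\{r,b,y\}$ in which no triangle has a coloring belonging to $\mathcal{H}$. For an edge-coloring $c$ of $K_n$, $h_2(c)$ is the maximum $k$ such that there is a set of $k$ vertices whose induced edges use at most two of the three colors. Finally, $h_2(n,\mathcal{H})=\min\{h_2(c): c\in\operatorname{Forb}(n,\mathcal{H})\}$. Here $\log$ is the base-2 logarithm. *)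

(* Defs.v *)
From HB Require Import structures.
From mathcomp Require Import all_boot all_order all_algebra.
From mathcomp Require Import finmap multiset.
From mathcomp Require Import boolp classical_sets reals topology normedtype.
From mathcomp Require Import landau exp.
Import GRing.Theory Num.Theory numFieldNormedType.Exports.

Set Implicit Arguments.
Unset Strict Implicit.
Unset Printing Implicit Defensive.

Inductive color := red | blue | yellow.

Definition color_code (a : color) : option bool :=
  match a with red => None | blue => Some true | yellow => Some false end.

Definition color_decode (o : option bool) : color :=
  match o with None => red | Some true => blue | Some false => yellow end.

Lemma color_codeK : cancel color_code color_decode.
Proof. by case. Qed.

HB.instance Definition _ := Countable.copy color (can_type color_codeK).
HB.instance Definition _ : isFinite color := CanIsFinite color_codeK.

Local Open Scope fset_scope.
Local Open Scope mset_scope.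
Local Open Scope nat_scope.

(* A pattern is the multiset of the colors of the three edges of a triangle.  *)
(* Multisets whose size is not 3 are allowed by the type, but no triangle has *)
(* them as its pattern.                                                       *)
Definition pattern := {mset color}.

Definition rrr : pattern := [mset red; red; red].
Definition rrb : pattern := [mset red; red; blue].

Section Colorings.
Variable n : nat.

Definition edge := {e : {set 'I_n} | #|e| == 2}.

Definition coloring := {ffun edge -> color}.

Implicit Types (c : coloring) (S T : {set 'I_n}) (H : {fset pattern}).

Definition edges_in S : {set edge} := [set e : edge | val e \subset S].

Definition triangle_pattern c T : pattern :=
  seq_mset [seq c e | e in edges_in T].

Definition Forb H : {set coloring} :=
  [set c : coloring |
    [forall T : {set 'I_n}, (#|T| == 3) ==> (triangle_pattern c T \notin H)]].

Definition h2_coloring c : nat :=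
  \max_(S : {set 'I_n} | #|c @: edges_in S| <= 2) #|S|.

(* Every c satisfies h2_coloring c <= n, so the neutral element n does not    *)
(* affect the minimum unless Forb H is empty, in which case the value is n.   *)
Definition h2 H : nat := \big[minn/n]_(c in Forb H) h2_coloring c.

End Colorings.

Local Open Scope ring_scope.

Definition log2 (R : realType) (x : R) : R := ln x / ln 2.

(* Main.v *)
Require Import Defs.
From HB Require Import structures.
From mathcomp Require Import all_boot all_order all_algebra.
From mathcomp Require Import finmap multiset.
From mathcomp Require Import reals sequences exp.
From mathcomp Require Import ring lra zify.
Import Order.TTheory GRing.Theory Num.Theory.

Set Implicit Arguments.
Unset Strict Implicit.
Unset Printing Implicit Defensive.

(**
A coloring avoids [rrr] and [rrb] iff its red graph is triangle-free and every
pair with a common red neighbour is yellow.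

Lower bound: a red neighbourhood is a yellow clique, so either some red degree
is at least [d ~ sqrt (n log n)], or the red graph is triangle-free of maximum
degree below [d] and has a stable set of size of order [n log d / d].

Upper bound (it even gives [O(sqrt n log n)]): let [X] be a random graph with
edge probability [1 / q], where [q] is a large multiple of [sqrt n], and delete
the edges of a maximal family of edge-disjoint triangles.  Color the remaining
edges red, the pairs with a common red neighbour yellow and the others blue.
With [K ~ q log n], a set of size [K] is not red-free, by a union bound over the
families of edge-disjoint triangles that could have destroyed its edges.  In a
blue-free set [S] every pair is covered by a neighbourhood in [X], so that
[\sum_v |N(v) :&: S| ^ 2] would be about [|S| ^ 2], which is excluded by
exponential moments when [|S| = K].  In a yellow-free set the red edges form a
matching, so half of it is red-free.
*)

(** * Stable sets in triangle-free graphs *)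

Section TriangleFree.
Variables (V : finType) (e : rel V).
Hypothesis e_sym : symmetric e.
Hypothesis e_free : forall x y z, e x y -> e y z -> ~~ e x z.

Definition nbrs x := [set y | e x y].

Definition stable (W : {set V}) := [forall x in W, forall y in W, ~~ e x y].

Lemma stableP (W : {set V}) :
  reflect {in W &, forall x y, ~~ e x y} (stable W).
Proof.
apply: (iffP forall_inP) => [H x y xW yW|H x xW].
  by move/forall_inP: (H x xW); apply.
by apply/forall_inP => y yW; apply: H.
Qed.

Lemma triangle_free_irr x : ~~ e x x.
Proof. by apply/negP => exx; move: (e_free exx exx); rewrite exx. Qed.

(** Complementation in [X] pairs [Y] with [X :\: Y], and the two sizes add up to [#|X|]. It gives
    the mean size of a uniform subset of the neighbours that are free to enter a stable set. *)
Lemma sum_card_powerset (X : {set V}) :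
  2 * \sum_(Y in powerset X) #|Y| = #|X| * 2 ^ #|X|.
Proof.
rewrite mul2n -addnn.
rewrite {2}(reindex_onto (fun Y => X :\: Y) (fun Y => X :\: Y)) /=; last first.
  by move=> Y; rewrite powersetE => /setIidPr YX; rewrite setDDr setDv set0U.
rewrite [X in _ + X](eq_bigl (fun Y => Y \in powerset X)); last first.
  move=> Y; rewrite !powersetE subsetDl /= setDDr setDv set0U.
  by apply/eqP/idP => [<-|/setIidPr //]; apply: subsetIl.
rewrite -big_split /= (eq_bigr (fun=> #|X|)).
  by rewrite sum_nat_const card_powerset mulnC.
move=> Y; rewrite powersetE => YX.
by rewrite -(cardsID Y X) (setIidPr YX).
Qed.

Variables (d L : nat).
Hypothesis d_ge : 4 ^ L <= d.
Hypothesis deg_le : forall x, #|nbrs x| <= d.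

Let F v (W : {set V}) := 4 * d * (v \in W) + 4 * #|nbrs v :&: W|.

(** For [L <= x] the second summand suffices. For [x < L] the left side is at most
    [2 ^ L * 2 ^ L = 4 ^ L], which [d_ge] bounds by [d]. *)
Lemma stable_fiber_arith x : L * (2 ^ x).+1 <= 4 * d + 2 * (x * 2 ^ x).
Proof.
have h : forall k, 0 < 2 ^ k by move=> k; rewrite expn_gt0.
have [Lx|xL] := leqP L x.
  apply: leq_trans (leq_addl _ _).
  rewrite mulnCA leq_mul // mul2n -addnn -addn1 leq_add2l; exact: h.
apply: leq_trans (leq_addr _ _).
apply: (@leq_trans (4 * 4 ^ L)); last by rewrite leq_mul2l.
have -> : 4 ^ L = 2 ^ L * 2 ^ L by rewrite -expnD addnn -mul2n expnM.
have /ltnW LL : L < 2 ^ L by apply: ltn_expl.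
have xx : (2 ^ x).+1 <= 2 ^ L by rewrite ltn_exp2l.
by rewrite mulnA; apply: leq_mul => //; apply: (leq_trans LL); apply: leq_pmull.
Qed.

(** A stable set with trace [H] outside the closed neighbourhood of [v] is either [v |: H] or
    [H :|: Y], where [Y] is an arbitrary set of neighbours of [v] that see nothing in [H]:
    triangle-freeness makes any such [Y] stable. The first set contributes [4 * d] to the sum, the
    others contribute through [#|Y|]. *)
Lemma stable_fiber v (H : {set V}) :
  L * #|[set W | stable W & W :\: (v |: nbrs v) == H]| <=
  \sum_(W | stable W && (W :\: (v |: nbrs v) == H)) F v W.
Proof.
set Nv := v |: nbrs v.
set Fib := [set W | _ & _].
have [->|[W0]] := set_0Vmem Fib; first by rewrite cards0 muln0.
rewrite inE => /andP[stW0 /eqP HW0].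
have HNv u : u \in H -> u \notin Nv by rewrite -HW0 inE => /andP[].
have HW u : u \in H -> u \in W0 by rewrite -HW0 inE => /andP[].
have stH : {in H &, forall x y, ~~ e x y}.
  by move=> x y /HW xW /HW yW; apply: (stableP _ stW0).
have vH : v \notin H by apply/negP => /HNv; rewrite !inE eqxx.
have HNe u : u \in H -> ~~ e v u.
  by move=> /HNv; rewrite !inE negb_or => /andP[].
pose X := [set u in nbrs v | [forall w in H, ~~ e u w]].
pose A := [set H :|: Y | Y in powerset X].
have XN Y : Y \in powerset X -> {subset Y <= nbrs v}.
  by rewrite powersetE => /subsetP YX y /YX; rewrite inE => /andP[].
have XH Y : Y \in powerset X -> forall y w, y \in Y -> w \in H -> ~~ e y w.
  rewrite powersetE => /subsetP YX y w /YX; rewrite inE => /andP[_ /forall_inP].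
  by move=> h; apply: h.
have vY Y : Y \in powerset X -> v \notin Y.
  move=> YX; apply/negP => /(XN _ YX); rewrite inE; apply/negP.
  exact: triangle_free_irr.
have vHFib : v |: H \in Fib.
  rewrite inE; apply/andP; split.
    apply/stableP => x y; rewrite !inE => /orP[/eqP->|xH] /orP[/eqP->|yH].
    - exact: triangle_free_irr.
    - exact: HNe.
    - by rewrite e_sym; apply: HNe.
    - exact: stH.
  apply/eqP/setP => u; rewrite !inE; case: eqVneq => [->|_] /=.
    by rewrite (negPf vH).
  by case: (boolP (u \in H)) => [/HNe ->|]; rewrite ?andbF.
have AFib : A \subset Fib.
  apply/subsetP => _ /imsetP[Y YX ->]; rewrite inE; apply/andP; split.
    apply/stableP => x y; rewrite !inE => /orP[xH|xY] /orP[yH|yY].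
    - exact: stH.
    - by rewrite e_sym; apply: (XH _ YX).
    - exact: (XH _ YX).
    - move: (XN _ YX _ xY) (XN _ YX _ yY); rewrite !inE e_sym => h1 h2.
      exact: (e_free h1 h2).
  apply/eqP/setP => u; rewrite !inE.
  case: (boolP (u \in H)) => [/HNv|uH]; first by rewrite !inE => ->.
  case: (boolP (u \in Y)) => [/(XN _ YX)|]; last by rewrite andbF.
  by rewrite inE => ->; rewrite orbT.
have vA : v |: H \notin A.
  apply/negP => /imsetP[Y YX] /setP /(_ v); rewrite !inE eqxx (negPf vH) /=.
  by rewrite (negPf (vY _ YX)).
have injA : {in powerset X &, injective (fun Y => H :|: Y)}.
  have dj Y : Y \in powerset X -> (H :|: Y) :\: H = Y.
    move=> YX; apply/setP => u; rewrite !inE.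
    case: (boolP (u \in H)) => [/HNe uH|//] /=.
    by apply/esym/negP => /(XN _ YX); rewrite inE; apply/negP.
  by move=> Y1 Y2 h1 h2 h; rewrite -(dj _ h1) -(dj _ h2) h.
have FibE : Fib = (v |: H) |: A.
  apply/eqP; rewrite eqEsubset; apply/andP; split; last first.
    by rewrite subUset sub1set vHFib.
  apply/subsetP => W; rewrite inE => /andP[/stableP stW /eqP WH].
  have HWs : {subset H <= W} by move=> u; rewrite -WH inE => /andP[].
  rewrite in_setU1; apply/orP; case: (boolP (v \in W)) => vW.
    left; apply/eqP/setP => u; rewrite -WH !inE.
    case: eqVneq => [->//|_] /=.
    by case: (boolP (u \in W)) => [uW|]; rewrite ?andbF //
      (negPf (stW _ _ vW uW)).
  right; apply/imsetP; exists (W :&: nbrs v).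
    rewrite powersetE; apply/subsetP => u; rewrite !inE => /andP[uW ->] /=.
    by apply/forall_inP => w /HWs wW; apply: stW.
  apply/setP => u; rewrite -WH !inE.
  case: (boolP (u \in W)) => [uW|]; rewrite ?andbF //=.
  case: eqVneq => [uv|_] /=; first by rewrite -uv uW in vW.
  by rewrite andbT orNb.
rewrite (eq_bigl (fun W => W \in Fib)); last by move=> W; rewrite inE.
rewrite FibE cardsU1 vA (big_setU1 _ vA) /= card_in_imset // card_powerset add1n.
apply: (leq_trans (stable_fiber_arith _)); apply: leq_add.
  by rewrite /F setU11 muln1 leq_addr.
rewrite big_imset //= -sum_card_powerset mulnA big_distrr /=.
apply: leq_sum => Y YX; apply: leq_trans (leq_addl _ _).
rewrite leq_mul2l /=; apply: subset_leq_card; apply/subsetP => y yY.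
by rewrite in_setI (XN _ YX _ yY) inE yY orbT.
Qed.

Lemma sum_nbrs_in (W : {set V}) :
  \sum_v #|nbrs v :&: W| = \sum_(w in W) #|nbrs w|.
Proof.
under eq_bigr do rewrite -sum1_card.
rewrite (exchange_big_dep (mem W)) /=; last by move=> v w _; rewrite inE => /andP[].
apply: eq_bigr => w wW; rewrite -sum1_card; apply: eq_bigl => v.
by rewrite !inE wW andbT e_sym.
Qed.

(* Alon-Spencer: [F v W / 4] is [d [v \in W] + |N(v) :&: W|]; conditionally on
   [W] outside the closed neighbourhood of [v], a uniform stable set [W] takes
   [2 ^ x + 1] values and the mean of [F v W] is at least [L]. *)
Theorem triangle_free_stable :
  exists2 W : {set V}, stable W & L * #|V| <= 8 * d * #|W|.
Proof.
have key v : L * #|[set W | stable W]| <= \sum_(W | stable W) F v W.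
  rewrite (partition_big (fun W => W :\: (v |: nbrs v)) predT) //=.
  rewrite -sum1_card.
  rewrite (partition_big (fun W => W :\: (v |: nbrs v)) predT) //= big_distrr /=.
  apply: leq_sum => H _; apply: leq_trans (stable_fiber v H).
  rewrite -sum1_card leq_eqVlt; apply/orP; left; apply/eqP; congr (_ * _).
  by apply: eq_bigl => W; rewrite !inE.
have tot : L * #|V| * #|[set W | stable W]| <=
           \sum_(W | stable W) 8 * d * #|W|.
  apply: (@leq_trans (\sum_v \sum_(W | stable W) F v W)).
    rewrite mulnAC mulnC -sum_nat_const; apply: leq_sum => v _; exact: key.
  rewrite exchange_big /=; apply: leq_sum => W _.
  rewrite big_split /= -!big_distrr /= sum_nbrs_in.
  have -> : \sum_v (v \in W : nat) = #|W|.
    by rewrite -sum1_card [RHS]big_mkcond.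
  have le : \sum_(w in W) #|nbrs w| <= d * #|W|.
    by rewrite mulnC -sum_nat_const; apply: leq_sum => w _; apply: deg_le.
  have -> : 8 * d * #|W| = 4 * d * #|W| + 4 * (d * #|W|).
    by rewrite mulnA -mulnDl -mulnDl.
  by rewrite leq_add2l leq_mul2l.
have [/existsP[W /andP[? ?]]|] :=
    boolP [exists W, stable W && (L * #|V| <= 8 * d * #|W|)]; first by exists W.
(* If every stable set failed the bound, summing would contradict [tot]. The empty set is singled
   out because one strict inequality is needed and it is known to be stable. *)
rewrite negb_exists => /forallP no.
have st0 : stable set0 by apply/stableP => x y; rewrite inE.
move: tot; rewrite leqNgt; case/negP.
rewrite [X in _ < X]mulnC -sum_nat_const.
rewrite [X in _ < X](eq_bigl stable); last by move=> W; rewrite inE.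
rewrite [X in X < _](bigD1 set0) // [X in _ < X](bigD1 set0) //= -addSn.
apply: leq_add.
  by move: (no set0); rewrite st0 /= -ltnNge.
by apply: leq_sum => W /andP[stW _]; move: (no W); rewrite stW /= -ltnNge => /ltnW.
Qed.

End TriangleFree.

(** * Random subsets of a finite type *)

Local Open Scope ring_scope.

Lemma sum_prod_subset (R : comPzRingType) (E : finType) (F G : E -> R) :
  \sum_(X : {set E}) \prod_i (if i \in X then F i else G i) =
  \prod_i (F i + G i).
Proof. by rewrite bigA_distr. Qed.

Lemma sum_expr_card (R : comPzRingType) (E : finType) (U : {set E}) (x : R) :
  \sum_(F : {set E} | F \subset U) x ^+ #|F| = (1 + x) ^+ #|U|.
Proof.
transitivity (\prod_i ((if i \in U then x else 0) + 1)); last first.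
  rewrite -prodr_const [RHS]big_mkcond; apply: eq_bigr => i _.
  by case: ifP; rewrite ?add0r // addrC.
rewrite -sum_prod_subset big_mkcond; apply: eq_bigr => F _.
case: ifPn => [/subsetP FU|/subsetPn[i iF iU]].
  rewrite -prodr_const big_mkcond; apply: eq_bigr => i _.
  by case: ifP => // /FU ->.
by rewrite (bigD1 i) //= iF (negPf iU) mul0r.
Qed.

Section RandomSubset.
Variables (R : realType) (E : finType) (p : R).
Hypothesis p01 : 0 <= p <= 1.

(** The law of a random subset that contains each element independently with probability [p]. *)
Definition weight (X : {set E}) : R := \prod_i (if i \in X then p else 1 - p).

Definition Pr (Q : pred {set E}) : R := \sum_(X | Q X) weight X.

Lemma weight_ge0 X : 0 <= weight X.
Proof.
have [p0 p1] := andP p01.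
by apply: prodr_ge0 => i _; case: ifP => // _; rewrite subr_ge0.
Qed.

Lemma Pr_setT : Pr predT = 1.
Proof.
rewrite /Pr (sum_prod_subset (fun=> p) (fun=> 1 - p)) big1 // => i _.
by rewrite addrC subrK.
Qed.

Lemma Pr_sub (P Q : pred {set E}) : (forall X, P X -> Q X) -> Pr P <= Pr Q.
Proof.
move=> PQ; rewrite /Pr [leRHS](bigID P) /=.
rewrite (eq_bigl P) => [|X]; last by apply/andP/idP => [[]//|PX]; rewrite PQ.
by rewrite ler_wpDr // sumr_ge0 // => X _; apply: weight_ge0.
Qed.

Lemma Pr_union (I : finType) (P : pred I) (Q : I -> pred {set E}) :
  Pr (fun X => [exists i, P i && Q i X]) <= \sum_(i | P i) Pr (Q i).
Proof.
rewrite /Pr (exchange_big_dep predT) //= big_mkcond /=; apply: ler_sum => X _.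
case: existsP => [[i /andP[Pi Qi]]|_]; last first.
  by apply: sumr_ge0 => i _; apply: weight_ge0.
rewrite (bigD1 i) /=; last by rewrite Pi Qi.
by rewrite ler_wpDr // sumr_ge0 // => j _; apply: weight_ge0.
Qed.

Lemma Pr_or (P Q : pred {set E}) : Pr (fun X => P X || Q X) <= Pr P + Pr Q.
Proof.
rewrite /Pr big_mkcond [X in _ <= X + _]big_mkcond [X in _ <= _ + X]big_mkcond.
rewrite -big_split /=; apply: ler_sum => X _.
have := weight_ge0 X.
by case: (P X); case: (Q X) => //=; lra.
Qed.

Lemma Pr_lt1 (Q : pred {set E}) : Pr Q < 1 -> exists X, ~~ Q X.
Proof.
move=> lt1; have [/forallP QT|] := boolP [forall X, Q X]; last first.
  by rewrite negb_forall => /existsP.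
suff Q1 : Pr Q = 1 by move: lt1; rewrite Q1 ltxx.
by rewrite -[RHS]Pr_setT; apply: eq_bigl => X; rewrite QT.
Qed.

Lemma Pr_sub_disjoint (A B : {set E}) : [disjoint A & B] ->
  Pr (fun X => (A \subset X) && [disjoint B & X]) = p ^+ #|A| * (1 - p) ^+ #|B|.
Proof.
move=> AB.
(* Each factor adds the contributions of [i \in X] and [i \notin X], the one that the event forbids
   being replaced by 0. *)
transitivity (\prod_i ((if i \in B then 0 else p) +
                       (if i \in A then 0 else 1 - p))); last first.
  rewrite (bigID (mem A)) /=; congr (_ * _).
    rewrite (eq_bigr (fun=> p)) ?prodr_const // => i iA.
    by rewrite (disjointFr AB iA) iA addr0.
  rewrite (bigID (mem B)) /= [X in _ * X]big1 ?mulr1; last first.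
    by move=> i /andP[/negPf -> /negPf ->]; rewrite addrC subrK.
  rewrite (eq_bigl (mem B)) => [|i]; last first.
    by apply: andb_idl => iB; rewrite /= (disjointFl AB (iB : i \in B)).
  rewrite (eq_bigr (fun=> 1 - p)) ?prodr_const // => i iB.
  by rewrite (iB : i \in B) (disjointFl AB iB) add0r.
rewrite -sum_prod_subset /Pr big_mkcond /=; apply: eq_bigr => X _.
case: ifPn => [/andP[/subsetP AX BX]|].
  apply: eq_bigr => i _; case: ifPn => iX.
    by rewrite (disjointFl BX iX).
  by case: ifP => // /AX; rewrite (negPf iX).
rewrite negb_and => /orP[/subsetPn[i iA iX]|].
  by rewrite (bigD1 i) //= (negPf iX) iA mul0r.
rewrite disjoint_sym => /pred0Pn[i /andP[iX iB]].
by rewrite (bigD1 i) //= (iX : i \in X) (iB : i \in B) mul0r.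
Qed.

Lemma weight_mgf (U : {set E}) (z : R) :
  \sum_X weight X * z ^+ #|X :&: U| = (1 + p * (z - 1)) ^+ #|U|.
Proof.
transitivity (\prod_i ((p * (if i \in U then z else 1)) + (1 - p))); last first.
  rewrite (bigID (mem U)) /= [X in _ * X]big1 ?mulr1; last first.
    by move=> i /negPf ->; rewrite mulr1 addrC subrK.
  rewrite (eq_bigr (fun=> 1 + p * (z - 1))) ?prodr_const // => i ->.
  by rewrite mulrBr mulr1 addrC -addrA [- p + _]addrC.
rewrite -sum_prod_subset; apply: eq_bigr => X _.
rewrite /weight -prodr_const [X in _ * X]big_mkcond -big_split /=.
by apply: eq_bigr => i _; rewrite inE; case: (i \in X); rewrite ?mulr1.
Qed.

(** From [1 + x <= expR x] at [x = - 1/2] follows [expR (1/2) <= 2]; then take the fourth power. The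
    constant 16 of the tail bound comes from here. *)
Lemma expR2_le16 : expR 2 <= 16 :> R.
Proof.
have h : expR (- 2^-1) >= 2^-1 :> R.
  by apply: le_trans (expR_ge1Dx _); lra.
have : expR (2^-1) <= 2 :> R.
  rewrite -[leRHS]invrK -[leLHS]invrK.
  by rewrite lef_pV2 -?expRN ?posrE ?expR_gt0 // invr_gt0.
move=> h2; have -> : 2 = 4%:R * 2^-1 :> R by lra.
rewrite expRM_natl; have -> : 16 = 2 ^+ 4 :> R by rewrite -natrX.
by apply: lerXn2r => //; rewrite ?nnegrE ?expR_ge0.
Qed.

(** Chernoff bound with base [z = expR 2]: the exponential moment is at most
    [expR (16 * p) ^+ #|U| <= expR k], and Markov's inequality at [expR (2 * k)] leaves
    [expR (- k)]. *)
Lemma Pr_tail (U : {set E}) (k : R) : 16 * p * #|U|%:R <= k ->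
  Pr (fun X => k <= #|X :&: U|%:R) <= expR (- k).
Proof.
move=> Uk; have [p0 p1] := andP p01.
have e1 : 1 <= expR 2 :> R by rewrite (le_trans _ (expR_ge1Dx _)) //; lra.
have : Pr (fun X => k <= #|X :&: U|%:R) * expR (2 * k) <= expR k.
  rewrite /Pr mulr_suml.
  apply: (@le_trans _ _ (\sum_X weight X * expR 2 ^+ #|X :&: U|)).
    rewrite big_mkcond /=; apply: ler_sum => X _; case: ifP => kX.
      rewrite ler_wpM2l ?weight_ge0 // -expRM_natr ler_expR; lra.
    by rewrite mulr_ge0 ?weight_ge0 // exprn_ge0 // expR_ge0.
  rewrite weight_mgf.
  apply: (@le_trans _ _ (expR (16 * p) ^+ #|U|)); last first.
    by rewrite -expRM_natr ler_expR.
  apply: lerXn2r; rewrite ?nnegrE ?expR_ge0 //.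
    by rewrite addr_ge0 // mulr_ge0 // subr_ge0.
  apply: le_trans (expR_ge1Dx _); rewrite lerD2l mulrC ler_wpM2r //.
  by have := expR2_le16; lra.
have -> : expR k = expR (- k) * expR (2 * k) by rewrite -expRD; congr expR; lra.
by rewrite ler_pM2r // expR_gt0.
Qed.

End RandomSubset.

(** * Edge sets and triangle packings *)

Local Open Scope nat_scope.

Section EdgeSets.
Variable n : nat.
Implicit Types (X : {set edge n}) (S B t : {set 'I_n}).

Definition adj X x y := [exists e in X, val e == [set x; y]].

Definition nbr X x := [set y | adj X x y].

Lemma adj_sym X : symmetric (adj X).
Proof. by move=> x y; rewrite /adj setUC. Qed.

Lemma adj_irr X x : ~~ adj X x x.
Proof.
apply/negP => /exists_inP[[e /= /eqP e2] _ /eqP ee].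
by move: e2; rewrite ee setUid cards1.
Qed.

Lemma adjP X x y : reflect (exists2 e, e \in X & val e = [set x; y]) (adj X x y).
Proof.
by apply: (iffP exists_inP) => -[e eX he]; exists e => //; apply/eqP.
Qed.

Lemma edge_ends (e : edge n) : exists x y, x != y /\ val e = [set x; y].
Proof.
by have /cards2P[x [y]] := valP e; exists x, y.
Qed.

Lemma card_edges_in S : #|edges_in S| = 'C(#|S|, 2).
Proof.
rewrite -cards_draws -(card_imset _ val_inj).
apply: eq_card => A; rewrite !inE; apply/imsetP/andP.
  by case=> e; rewrite inE => eS ->; split=> //; exact: (valP e).
by case=> AS A2; exists (Sub A A2) => //; rewrite inE.
Qed.

Definition edges_between S B : {set edge n} :=
  [set e | [exists s in S, [exists b in B, val e == [set s; b]]]].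

Lemma card_edges_between S B : #|edges_between S B| <= #|S| * #|B|.
Proof.
rewrite -cardsX -(card_imset _ val_inj).
apply: leq_trans (leq_imset_card (fun u => [set u.1; u.2]) _).
apply: subset_leq_card; apply/subsetP => _ /imsetP[e + ->].
rewrite inE => /exists_inP[s sS /exists_inP[b bB /eqP ->]].
by apply/imsetP; exists (s, b); rewrite ?inE ?sS ?bB.
Qed.

Definition degree_sum X S B := \sum_(b in B) #|nbr X b :&: S|.

(** Each counted pair is charged to its edge; an edge with both ends in [S :&: B] is charged from
    either end, whence the factor 2. *)
Lemma degree_sum_le X S B : degree_sum X S B <= 2 * #|X :&: edges_between S B|.
Proof.
have -> : degree_sum X S B = \sum_(u in setX B S) adj X u.1 u.2.
  transitivity (\sum_(b in B) \sum_(s in S) (adj X b s : nat)); last first.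
    by rewrite pair_big /=; apply: eq_bigl => -[b s]; rewrite inE.
  apply: eq_bigr => b _; rewrite -sum1_card big_mkcond /= [RHS]big_mkcond.
  apply: eq_bigr => s _;
    by rewrite !inE; case: (s \in S); rewrite ?andbF ?andbT //; case: adj.
apply: (@leq_trans (\sum_(u in setX B S)
    \sum_(e in X :&: edges_between S B) (val e == [set u.1; u.2]))).
  apply: leq_sum => -[b s]; rewrite inE /= => /andP[bB sS].
  case: adjP => // -[e eX ee].
  rewrite (bigD1 e) /=; first by rewrite ee eqxx.
  rewrite inE eX inE /=; apply/exists_inP; exists s => //.
  by apply/exists_inP; exists b => //; rewrite ee setUC.
rewrite exchange_big /= mulnC -sum_nat_const; apply: leq_sum => e _.
have [x [y [_ ->]]] := edge_ends e.
apply: (@leq_trans #|[set (x, y); (y, x)]|); last by rewrite cards2; case: eqP.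
rewrite -sum1_card [X in X <= _]big_mkcond [X in _ <= X]big_mkcond /=.
apply: leq_sum => -[a b] _; case: ifP => // _ /=.
case: eqP => // xy.
have hx : x \in [set a; b] by rewrite -xy !inE eqxx.
have hy : y \in [set a; b] by rewrite -xy !inE eqxx orbT.
have ha : a \in [set x; y] by rewrite xy !inE eqxx.
have hb : b \in [set x; y] by rewrite xy !inE eqxx orbT.
suff -> : (a, b) \in [set (x, y); (y, x)] by [].
move: hx hy; case/set2P: ha => ->; case/set2P: hb => ->;
  rewrite !inE ?eqxx ?orbT //= orbb.
- by move=> _ /eqP ->; rewrite eqxx.
- by move=> /eqP ->; rewrite eqxx.
Qed.

(** * Triangle-free edge sets and maximum triangle packings *)

Definition triangle_free X := forall t, #|t| = 3 -> ~~ (edges_in t \subset X).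

Lemma edges_in3 x y z : x != y -> x != z -> y != z ->
  forall e : edge n, e \in edges_in [set x; y; z] ->
  [\/ val e = [set x; y], val e = [set x; z] | val e = [set y; z]].
Proof.
move=> xy xz yz e; rewrite inE => es.
have [a [b [ab eab]]] := edge_ends e; rewrite eab in es *.
move: es; rewrite subUset !sub1set !inE.
move=> /andP[/orP[/orP[]|] /eqP ? /orP[/orP[]|] /eqP ?]; subst a b;
  rewrite ?eqxx // in ab *; try (by constructor 1); try (by constructor 2);
  try (by constructor 3); try (by rewrite setUC; constructor 1);
  try (by rewrite setUC; constructor 2); by rewrite setUC; constructor 3.
Qed.

Lemma triangle_free_adj X : triangle_free X ->
  forall x y z, adj X x y -> adj X y z -> ~~ adj X x z.
Proof.
move=> tf x y z xy yz; apply/negP => xz.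
have nxy : x != y by apply/negP => /eqP xE; move: xy; rewrite xE (negPf (adj_irr _ _)).
have nyz : y != z by apply/negP => /eqP xE; move: yz; rewrite xE (negPf (adj_irr _ _)).
have nxz : x != z by apply/negP => /eqP xE; move: xz; rewrite xE (negPf (adj_irr _ _)).
have c3 : #|[set x; y; z]| = 3.
  by rewrite setUC cardsU1 cards2 !inE negb_or nxy ![z == _]eq_sym nxz nyz.
have /subsetPn[e /(edges_in3 nxy nxz nyz) he eX] := tf _ c3.
move: eX; case: he => he; apply/negP; rewrite negbK.
- by have [e' e'X /esym] := adjP _ _ _ xy; rewrite -he => /val_inj ->.
- by have [e' e'X /esym] := adjP _ _ _ xz; rewrite -he => /val_inj ->.
- by have [e' e'X /esym] := adjP _ _ _ yz; rewrite -he => /val_inj ->.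
Qed.

Definition edge_disjoint (F : {set {set 'I_n}}) :=
  [forall t in F, #|t| == 3] &&
  [forall t in F, forall t' in F, (t != t') ==> [disjoint edges_in t & edges_in t']].

Definition packing X F := edge_disjoint F && [forall t in F, edges_in t \subset X].

Definition max_packing X := [arg max_(F > set0 | packing X F) #|F|].

Definition prune X := X :\: \bigcup_(t in max_packing X) edges_in t.

Lemma packing0 X : packing X set0.
Proof.
by apply/andP; split; [apply/andP; split|]; apply/forall_inP => t; rewrite inE.
Qed.

Lemma max_packingP X : packing X (max_packing X) /\
  forall F, packing X F -> #|F| <= #|max_packing X|.
Proof. by rewrite /max_packing; case: arg_maxnP => //; apply: packing0. Qed.

Lemma prune_sub X : prune X \subset X.
Proof. exact: subsetDl. Qed.

(** A surviving triangle would be edge-disjoint from the whole packing, so adding it would give a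
    larger packing. *)
Lemma prune_triangle_free X : triangle_free (prune X).
Proof.
move=> t t3; apply/negP => /subsetP tp.
have [/andP[/andP[/forall_inP F3 /forall_inP Fd] /forall_inP FX] Fmax] :=
  max_packingP X.
have td t' : t' \in max_packing X -> [disjoint edges_in t & edges_in t'].
  move=> t'F; rewrite disjoint_subset; apply/subsetP => e /tp.
  by rewrite !inE => /andP[+ _]; apply: contra => h; apply/bigcupP; exists t';
    rewrite ?inE.
have tF : t \notin max_packing X.
  apply/negP => /td; rewrite -setI_eq0 setIid => /eqP.
  by move/(congr1 (fun A : {set _} => #|A|)); rewrite card_edges_in t3 cards0.
suff /Fmax : packing X (t |: max_packing X) by rewrite cardsU1 tF add1n ltnn.
apply/andP; split; first (apply/andP; split).
- by apply/forall_inP => t'; rewrite !inE => /orP[/eqP->|/F3//]; rewrite t3.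
- apply/forall_inP => t1; rewrite in_setU1 => /orP[/eqP->|h1];
    apply/forall_inP => t2; rewrite in_setU1 => /orP[/eqP->|h2]; apply/implyP.
  + by rewrite eqxx.
  + by move=> _; apply: td.
  + by move=> _; rewrite disjoint_sym; apply: td.
  + by move=> n12; move/forall_inP: (Fd _ h1) => /(_ _ h2)/implyP; apply.
- apply/forall_inP => t'; rewrite in_setU1 => /orP[/eqP->|/FX//].
  by apply/subsetP => e /tp; rewrite inE => /andP[].
Qed.

Lemma card_edge_disjoint (F : {set {set 'I_n}}) : edge_disjoint F ->
  #|\bigcup_(t in F) edges_in t| = 3 * #|F|.
Proof.
move=> /andP[/forall_inP F3 /forall_inP Fd].
rewrite big_mkcond -sum1_card partition_disjoint_bigcup /= => [|t t' tt'].
  rewrite mulnC -sum_nat_const [RHS]big_mkcond; apply: eq_bigr => t _.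
  by case: ifP => [/F3/eqP t3|]; rewrite sum1_card ?cards0 // card_edges_in t3.
case: ifP => [tF|_]; last by rewrite disjoints_subset sub0set.
case: ifP => [t'F|_]; last by rewrite disjoint_sym disjoints_subset sub0set.
by move/forall_inP: (Fd _ tF) => /(_ _ t'F)/implyP; apply.
Qed.

Definition touching S : {set {set 'I_n}} :=
  [set t : {set 'I_n} | (#|t| == 3) && ~~ [disjoint edges_in t & edges_in S]].

(** A touching triple consists of an edge inside [S] and one further vertex. *)
Lemma card_touching S : #|touching S| <= 'C(#|S|, 2) * n.
Proof.
rewrite -card_edges_in -[n in _ * n]card_ord -cardsT -cardsX.
apply: leq_trans (leq_imset_card (fun u : edge n * 'I_n => u.2 |: val u.1) _).
apply: subset_leq_card; apply/subsetP => t.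
rewrite inE => /andP[/eqP t3 /pred0Pn[e /andP[et eS]]].
have et' : val e \subset t by move: et; rewrite /= inE.
have /cards1P[v tv] : #|t :\: val e| == 1.
  by rewrite cardsD (setIidPr et') t3 (eqP (valP e)).
apply/imsetP; exists (e, v); first by rewrite in_setX in_setT andbT.
by rewrite /= -tv -{1}(setID t (val e)) (setIidPr et') setUC.
Qed.

(** The certificate for the union bound: the members of the packing that touch [S] lie in [X] and
    account for all edges of [X] inside [S]. Restricting to touching triples keeps the number of
    possible certificates small. *)
Lemma prune_disjoint X S : [disjoint prune X & edges_in S] ->
  exists F : {set {set 'I_n}}, [/\ F \subset touching S, edge_disjoint F,
    \bigcup_(t in F) edges_in t \subset X &
    [disjoint edges_in S :\: \bigcup_(t in F) edges_in t & X]].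
Proof.
move=> dS.
have [/andP[/andP[/forall_inP F3 /forall_inP Fd] /forall_inP FX] _] :=
  max_packingP X.
exists (max_packing X :&: touching S); split.
- exact: subsetIr.
- apply/andP; split; first by apply/forall_inP => t; rewrite inE => /andP[/F3].
  apply/forall_inP => t1; rewrite inE => /andP[h1 _].
  apply/forall_inP => t2; rewrite inE => /andP[h2 _].
  by move/forall_inP: (Fd _ h1) => /(_ _ h2).
- by apply/bigcupsP => t; rewrite inE => /andP[/FX].
rewrite disjoint_subset; apply/subsetP => e; rewrite inE => /andP[eF eS].
apply/negP => /= eX.
have : e \notin prune X by rewrite (disjointFl dS eS).
rewrite inE eX andbT negbK => /bigcupP[t tF et].
case/negP: eF; apply/bigcupP; exists t => //.
rewrite inE tF inE F3 //=; apply/pred0Pn; exists e; exact/andP.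
Qed.

End EdgeSets.

(** * Random graphs *)

Local Open Scope ring_scope.

Section RandomGraph.
Variables (R : realType) (n : nat) (p : R).
Hypothesis p01 : 0 <= p <= 1.

(** A certificate [F] has probability at most [(1 - p) ^+ N * x ^+ #|F|], because its triangles have
    [3 * #|F|] distinct edges, so at least [N - 3 * #|F|] pairs of [S] must be absent. The sum over
    all [F] is at most [(1 - p) ^+ N * (1 + x) ^+ (N * n)], and [n%:R * x <= p / 2] preserves half
    of the exponent. *)
Lemma Pr_prune_disjoint (S : {set 'I_n}) : p < 1 ->
  n%:R * (p / (1 - p)) ^+ 3 <= p / 2 ->
  Pr p (fun X : {set edge n} => [disjoint prune X & edges_in S]) <=
    expR (- (p * 'C(#|S|, 2)%:R / 2)).
Proof.
move=> p1 np; have [p0 _] := andP p01; have q0 : 0 < 1 - p by rewrite subr_gt0.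
set x := (p / (1 - p)) ^+ 3 in np.
have x0 : 0 <= x by rewrite exprn_ge0 // divr_ge0 // ltW.
set N := 'C(#|S|, 2).
pose A (F : {set {set 'I_n}}) : {set edge n} := \bigcup_(t in F) edges_in t.
pose Q F (X : {set edge n}) := (A F \subset X) && [disjoint edges_in S :\: A F & X].
pose P (F : {set {set 'I_n}}) := (F \subset touching S) && edge_disjoint F.
apply: (@le_trans _ _ (Pr p (fun X => [exists F, P F && Q F X]))).
  apply: Pr_sub => // X /prune_disjoint[F [h1 h2 h3 h4]].
  by apply/existsP; exists F; rewrite /P /Q h1 h2 h3 h4.
apply: le_trans (Pr_union _ _ _) _ => //.
(* Edge-disjointness has served to bound each term; it is dropped here so that the binomial theorem
   applies to the sum over all subfamilies. *)
apply: (@le_trans _ _ (\sum_(F : {set {set 'I_n}} | F \subset touching S)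
    (1 - p) ^+ N * x ^+ #|F|)).
  rewrite [leRHS](bigID (fun F => edge_disjoint F)) /=.
  rewrite -[leLHS]addr0; apply: lerD; last first.
    by apply: sumr_ge0 => F _; rewrite mulr_ge0 // exprn_ge0 // ltW.
  apply: ler_sum => F /andP[_ Fd].
  rewrite Pr_sub_disjoint //; last first.
    by rewrite disjoint_sym disjoints_subset setDE subsetIr.
  rewrite /A card_edge_disjoint // -exprM expr_div_n mulrCA ler_wpM2l ?exprn_ge0 //.
  rewrite ler_pdivlMr ?exprn_gt0 // -exprD; apply: ler_wiXn2l.
  - exact: ltW.
  - by rewrite gerBl.
  rewrite -(card_edge_disjoint Fd) /N -card_edges_in.
  rewrite cardsD addnC -leq_subLR leq_sub2l // subset_leq_card // subsetIr //.
rewrite -mulr_sumr sum_expr_card.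
apply: (@le_trans _ _ (expR (- p) ^+ N * expR x ^+ (N * n))).
  apply: ler_pM.
  - by rewrite exprn_ge0 // ltW.
  - by rewrite exprn_ge0 // addr_ge0.
  - by apply: lerXn2r; rewrite ?nnegrE ?expR_ge0 ?(ltW q0) // expR_ge1Dx.
  apply: (@le_trans _ _ (expR x ^+ #|touching S|)).
    by apply: lerXn2r; rewrite ?nnegrE ?expR_ge0 ?addr_ge0 // expR_ge1Dx.
  apply: ler_weXn2l (card_touching S).
  by apply: le_trans (expR_ge1Dx _); rewrite lerDl.
rewrite -!expRM_natl -expRD ler_expR natrM.
have : N%:R * (n%:R * x) <= N%:R * (p / 2) by rewrite ler_wpM2l.
lra.
Qed.

Lemma Pr_degree_sum (S B : {set 'I_n}) (k : R) :
  32 * p * (#|S|%:R * #|B|%:R) <= k ->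
  Pr p (fun X => k <= (degree_sum X S B)%:R) <= expR (- (k / 2)).
Proof.
move=> h; have [p0 _] := andP p01.
apply: le_trans (Pr_tail p01 (U := edges_between S B) _); last first.
  have : p * #|edges_between S B|%:R <= p * (#|S|%:R * #|B|%:R).
    by rewrite ler_wpM2l // -natrM ler_nat card_edges_between.
  lra.
apply: Pr_sub => // X; rewrite ler_pdivrMr // => /le_trans; apply.
by rewrite mulrC -natrM ler_nat degree_sum_le.
Qed.

(** Both lower bounds on the degree sum are averaged. The share of [T * #|B|%:R] pays for the union
    bound over all [B], whose total factor [(1 + expR (- (T / 4))) ^+ n] is at most [expR 1]; the
    share of [M] gives the decay. *)
Lemma Pr_degree_sum_heavy (S : {set 'I_n}) (M T : R) :
  64 * p * #|S|%:R <= T -> 0 <= M -> n%:R * expR (- (T / 4)) <= 1 ->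
  Pr p (fun X => [exists B : {set 'I_n}, predT B &&
     ((M <= (degree_sum X S B)%:R) && (T * #|B|%:R <= (degree_sum X S B)%:R))]) <=
    expR (1 - M / 4).
Proof.
move=> hT M0 hn; apply: le_trans (Pr_union _ _ _) _ => //.
apply: (@le_trans _ _ (\sum_(B : {set 'I_n} | B \subset setT)
    expR (- (M / 4)) * expR (- (T / 4)) ^+ #|B|)).
  rewrite big_mkcond [leRHS]big_mkcond; apply: ler_sum => B _; rewrite subsetT /=.
  apply: (@le_trans _ _ (expR (- ((M + T * #|B|%:R) / 2 / 2)))); last first.
    by rewrite -expRM_natl -expRD ler_expR; lra.
  apply: le_trans (Pr_degree_sum (S := S) (B := B) _).
    by apply: Pr_sub => // X /andP[]; lra.
  have : 64 * p * #|S|%:R * #|B|%:R <= T * #|B|%:R by rewrite ler_wpM2r.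
  lra.
rewrite -mulr_sumr sum_expr_card cardsT card_ord.
apply: (@le_trans _ _ (expR (- (M / 4)) * expR (expR (- (T / 4))) ^+ n)).
  rewrite ler_wpM2l ?expR_ge0 //.
  by apply: lerXn2r; rewrite ?nnegrE ?expR_ge0 ?addr_ge0 ?expR_ge0 // expR_ge1Dx.
by rewrite -expRM_natl -expRD ler_expR; lra.
Qed.

End RandomGraph.

Lemma bin_le_expn n k : ('C(n, k) <= n ^ k)%N.
Proof.
have h : (n ^_ k <= n ^ k)%N.
  by elim: k => // k IH; rewrite ffactnSr expnSr leq_mul ?leq_subr.
apply: leq_trans h; by rewrite -bin_ffact leq_pmulr ?fact_gt0.
Qed.

(** Here [l] stands for an upper bound of [ln n] and [p = 1 / q], so that sets of size
    [K = 64 * q * l] have [p * K = 64 * l] and number at most [expR (K * l)]. Each of three bad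
    events has probability below 1/3. *)
Lemma exists_good_graph (R : realType) (n q l : nat) :
  (0 < l)%N -> (2 * l + 4 <= q)%N -> (64 * n <= q ^ 2)%N ->
  n%:R <= expR l%:R :> R ->
  exists X : {set edge n},
  [/\ forall x, (#|nbr X x| < q)%N,
      forall S : {set 'I_n}, #|S| = (64 * q * l)%N ->
        ~~ [disjoint prune X & edges_in S] &
      forall S B : {set 'I_n}, #|S| = (64 * q * l)%N ->
        (64 * (64 * l) * #|B| <= degree_sum X S B)%N ->
        (degree_sum X S B < 16 * (64 * q * l) * l)%N].
Proof.
move=> l0 ql nq nl.
set K := (64 * q * l)%N.
have q0 : (0 < q)%N by lia.
have K0 : (64 <= K)%N by rewrite /K; nia.
pose p : R := q%:R^-1.
have qR : 1 <= q%:R :> R by rewrite ler1n.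
have lR : 1 <= l%:R :> R by rewrite ler1n.
have q6 : 6 <= q%:R :> R by rewrite ler_nat; lia.
have qlR : 2 * l%:R + 4 <= q%:R :> R by rewrite -natrM -natrD ler_nat.
have p0 : 0 < p by rewrite invr_gt0; lra.
have pq : p * q%:R = 1 by rewrite mulVf // gt_eqF //; lra.
have p6 : p <= 6^-1 by rewrite lef_pV2 ?posrE //; lra.
have p01 : 0 <= p <= 1 by apply/andP; split; lra.
have nqR : 64 * n%:R <= q%:R ^+ 2 :> R.
  by rewrite -natrX -natrM ler_nat.
have np : 64 * n%:R * p <= q%:R.
  have : 64 * n%:R * p <= q%:R ^+ 2 * p by rewrite ler_wpM2r // ltW.
  by have -> : q%:R ^+ 2 * p = q%:R by rewrite expr2 -mulrA [_ * p]mulrC pq mulr1.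
have np2 : 64 * (n%:R * p ^+ 2) <= 1.
  have : 64 * n%:R * p * p <= q%:R * p by rewrite ler_wpM2r // ltW.
  by rewrite [q%:R * p]mulrC pq; lra.
have KE : K%:R = 64 * q%:R * l%:R :> R by rewrite /K !natrM.
clearbody K.
have pK : p * K%:R = 64 * l%:R by rewrite KE; nra.
have cardK : (#|[set S : {set 'I_n} | #|S| == K]|)%:R <= expR (K%:R * l%:R) :> R.
  rewrite card_draws card_ord; apply: (@le_trans _ _ ((n ^ K)%:R)).
    by rewrite ler_nat bin_le_expn.
  by rewrite natrX expRM_natl; apply: lerXn2r; rewrite ?nnegrE ?expR_ge0.
(* All three events are bounded by [expR (- 2)]; for the degrees this is where [2 * l + 4 <= q]
   enters. *)
have e2 : expR (- 2) < 3^-1 :> R.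
  rewrite expRN ltf_pV2 ?posrE ?expR_gt0 //.
  by apply: le_lt_trans (expR_gt1Dx _); lra.
pose E1 (X : {set edge n}) :=
  [exists x : 'I_n, predT x && (q%:R <= (degree_sum X setT [set x])%:R :> R)].
pose E2 (X : {set edge n}) :=
  [exists S : {set 'I_n}, (#|S| == K) && [disjoint prune X & edges_in S]].
(* [M / 4 = 4 * K * l] outweighs the [expR (K * l)] choices of [S], and [T] equals [64 * p * K], the
   least value that the heavy-set estimate admits. *)
pose M : R := 16 * K%:R * l%:R.
pose T : R := 64 * (64 * l%:R).
pose E3 (X : {set edge n}) := [exists S : {set 'I_n}, (#|S| == K) &&
   [exists B : {set 'I_n}, predT B &&
     ((M <= (degree_sum X S B)%:R) && (T * #|B|%:R <= (degree_sum X S B)%:R))]].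
have PE1 : Pr p E1 < 3^-1.
  apply: le_lt_trans e2; apply: le_trans (Pr_union p01 _ _) _.
  apply: (@le_trans _ _ (\sum_(i : 'I_n) expR (- (q%:R / 2)))).
    apply: ler_sum => x _; apply: Pr_degree_sum => //.
    by rewrite cardsT card_ord cards1; lra.
  rewrite sumr_const card_ord -[leLHS]mulr_natl.
  apply: (@le_trans _ _ (expR l%:R * expR (- (q%:R / 2)))).
    by apply: ler_wpM2r; rewrite ?expR_ge0.
  by rewrite -expRD ler_expR; lra.
have PE2 : Pr p E2 < 3^-1.
  apply: le_lt_trans e2; apply: le_trans (Pr_union p01 _ _) _.
  apply: (@le_trans _ _ (\sum_(S in [set S : {set 'I_n} | #|S| == K])
      expR (- (p * 'C(K, 2)%:R / 2)))).
    rewrite [leRHS](eq_bigl (fun S : {set 'I_n} => #|S| == K)); last first.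
      by move=> S; rewrite inE.
    apply: ler_sum => S /eqP <-; apply: Pr_prune_disjoint => //; first lra.
    (* Since [p <= 1/6], the cube costs a factor of at most 8, which [64 * (n * p ^+ 2) <= 1]
       absorbs. *)
    have h : p / (1 - p) <= 2 * p.
      by rewrite ler_pdivrMr; [nra | lra].
    have h0 : 0 <= p / (1 - p) by rewrite divr_ge0; lra.
    have h3 : (p / (1 - p)) ^+ 3 <= (2 * p) ^+ 3.
      by apply: lerXn2r; rewrite ?nnegrE //; lra.
    apply: (@le_trans _ _ (n%:R * (2 * p) ^+ 3)); first by rewrite ler_wpM2l.
    have : 64 * (n%:R * p ^+ 2) * p <= 1 * p by rewrite ler_wpM2r // ltW.
    have -> : n%:R * (2 * p) ^+ 3 = 8 * (n%:R * p ^+ 2) * p by ring.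
    lra.
  rewrite sumr_const -[leLHS]mulr_natl.
  apply: (@le_trans _ _ (expR (K%:R * l%:R) * expR (- (p * 'C(K, 2)%:R / 2)))).
    by apply: ler_wpM2r; rewrite ?expR_ge0.
  rewrite -expRD ler_expR.
  have -> : 'C(K, 2)%:R = K%:R * (K%:R - 1) / 2 :> R.
    have : ('C(K, 2) * 2)%:R = (K * K.-1)%:R :> R.
      by rewrite mulnC -mul_bin_diag bin1.
    rewrite !natrM -subn1 natrB; last exact: leq_trans K0.
    lra.
  have K64 : 64 <= K%:R :> R by rewrite ler_nat.
  rewrite mulrA mulrA pK; nra.
have PE3 : Pr p E3 < 3^-1.
  apply: le_lt_trans e2; apply: le_trans (Pr_union p01 _ _) _.
  apply: (@le_trans _ _ (\sum_(S in [set S : {set 'I_n} | #|S| == K])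
      expR (1 - M / 4))).
    rewrite [leRHS](eq_bigl (fun S : {set 'I_n} => #|S| == K)); last first.
      by move=> S; rewrite inE.
    apply: ler_sum => S /eqP SK; apply: Pr_degree_sum_heavy => //.
    - by rewrite SK -mulrA pK /T; lra.
    - by rewrite /M !mulr_ge0.
    apply: (@le_trans _ _ (expR l%:R * expR (- (T / 4)))).
      by apply: ler_wpM2r; rewrite ?expR_ge0.
    by rewrite -expRD expR_le1 /T; lra.
  rewrite sumr_const -[leLHS]mulr_natl.
  apply: (@le_trans _ _ (expR (K%:R * l%:R) * expR (1 - M / 4))).
    by apply: ler_wpM2r; rewrite ?expR_ge0.
  rewrite -expRD ler_expR /M.
  have K64 : 64 <= K%:R :> R by rewrite ler_nat.
  nra.
have [X] : exists X, ~~ (E1 X || E2 X || E3 X).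
  apply: (@Pr_lt1 R _ p).
  apply: le_lt_trans (Pr_or p01 _ _) _.
  have := Pr_or p01 E1 E2; lra.
rewrite !negb_or => /andP[/andP[h1 h2] h3]; exists X; split.
- move=> x; rewrite ltnNge; apply: contra h1 => h; apply/existsP; exists x => /=.
  by rewrite ler_nat /degree_sum big_set1 setIT.
- move=> S SK; apply: contra h2 => h; apply/existsP; exists S.
  by rewrite SK eqxx.
move=> S B SK h; rewrite ltnNge; apply: contra h3 => h'; apply/existsP; exists S.
rewrite SK eqxx /=; apply/existsP; exists B => /=.
by rewrite /M /T -!natrM !ler_nat h' h.
Qed.

(** * Colorings without the forbidden patterns *)

Local Open Scope nat_scope.

Local Notation forbidden := ([fset rrr; rrb]%fset : {fset pattern}).

Lemma bigminn_le_cond (I : finType) (P : pred I) (F : I -> nat) m i :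
  P i -> \big[minn/m]_(j | P j) F j <= F i.
Proof.
move=> Pi; have : i \in index_enum I by rewrite mem_index_enum.
elim: (index_enum I) => // a s IH; rewrite inE big_cons => /orP[/eqP <-|/IH le].
  by rewrite Pi geq_minl.
by case: ifP => // _; apply: leq_trans (geq_minr _ _) le.
Qed.

Section Colorings.
Variable n : nat.
Implicit Types (c : coloring n) (S t : {set 'I_n}).

Lemma triangle_patternE c t a :
  triangle_pattern c t a = #|[set e in edges_in t | c e == a]|.
Proof.
rewrite /triangle_pattern mset_seqE count_map -size_filter cardE.
apply/perm_size/uniq_perm => [||e]; try exact: enum_uniq.
  exact/filter_uniq/enum_uniq.
by rewrite mem_filter !mem_enum !inE andbC.
Qed.

Lemma sum_triangle_pattern c t : #|t| = 3 ->
  triangle_pattern c t red + triangle_pattern c t blue +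
  triangle_pattern c t yellow = 3.
Proof.
move=> t3; have <- : #|edges_in t| = 3 by rewrite card_edges_in t3.
rewrite !triangle_patternE -!sum1_card.
rewrite [X in X + _ + _]big_mkcond [X in _ + X + _]big_mkcond /=.
rewrite [X in _ + _ + X]big_mkcond [RHS]big_mkcond -!big_split /=.
by apply: eq_bigr => e _; rewrite !inE; case: (_ \subset _) => //=; case: (c e).
Qed.

Lemma rrrE a : rrr a = if a is red then 3 else 0.
Proof. by rewrite /rrr !msetE2 !msetnE; case: a. Qed.

Lemma rrbE a : rrb a = match a with red => 2 | blue => 1 | yellow => 0 end.
Proof. by rewrite /rrb !msetE2 !msetnE; case: a. Qed.

(** The forbidden patterns are those without yellow and with at most one blue edge; all later
    arguments use these two counts in place of multiset equality. *)
Lemma rrr_or_rrb (P : pattern) : P red + P blue + P yellow = 3 ->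
  P yellow = 0 -> P blue <= 1 -> P = rrr \/ P = rrb.
Proof.
move=> + y0; rewrite y0 addn0.
case b: (P blue) => [|[|//]] r _; [left|right]; apply/msetP => -[];
  rewrite ?rrrE ?rrbE //.
  by rewrite -r addn0.
by move: r; rewrite addn1 => -[].
Qed.

Lemma forbidden_triangle c t : #|t| = 3 ->
  triangle_pattern c t yellow = 0 -> triangle_pattern c t blue <= 1 ->
  triangle_pattern c t \in forbidden.
Proof.
move=> /(sum_triangle_pattern c) s3 y0 b1; rewrite in_fset2.
by case: (rrr_or_rrb s3 y0 b1) => ->; rewrite eqxx ?orbT.
Qed.

Lemma forbidden_triangleP c t : triangle_pattern c t \in forbidden ->
  triangle_pattern c t yellow = 0 /\ triangle_pattern c t blue <= 1.
Proof. by rewrite in_fset2 => /orP[]/eqP->; rewrite ?rrrE ?rrbE. Qed.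

Lemma edge_not_in3 x y z (e : edge n) : x != y -> x != z -> val e = [set y; z] ->
  [/\ #|[set x; y; z]| = 3, e \in edges_in [set x; y; z] &
   forall f, f \in edges_in [set x; y; z] -> f != e ->
     val f = [set x; y] \/ val f = [set x; z]].
Proof.
move=> xy xz eE.
have yz : y != z.
  by apply/negP => /eqP yz; have := valP e; rewrite /= eE yz setUid cards1.
split.
- by rewrite setUC cardsU1 cards2 !inE negb_or xy ![z == _]eq_sym xz yz.
- by rewrite inE eE subUset !sub1set !inE !eqxx !orbT.
move=> f /(edges_in3 xy xz yz)[->|->|fE]; [by left|by right|].
by move=> /eqP[]; apply: val_inj; rewrite fE eE.
Qed.

Lemma h2_coloring_ge c S a : {in edges_in S, forall e, c e != a} ->
  #|S| <= h2_coloring c.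
Proof.
move=> cS; apply: (@leq_bigmax_cond _ _ (fun S : {set 'I_n} => #|S|)).
have c2 : #|~: [set a]| = 2.
  rewrite cardsC1 -cardsT (_ : [set: color] = [set red; blue; yellow]).
    by rewrite setUC cardsU1 cards2 !inE.
  by apply/setP => -[]; rewrite !inE.
rewrite -[leqRHS]c2.
apply: subset_leq_card; apply/subsetP => _ /imsetP[e eS ->].
by rewrite !inE cS.
Qed.

(** Using at most two of the three colors amounts to missing some color [a], so homogeneous sets are
    treated one missing color at a time. *)
Lemma h2_coloring_le c k :
  (forall S a, {in edges_in S, forall e, c e != a} -> #|S| <= k) ->
  h2_coloring c <= k.
Proof.
move=> h; apply/bigmax_leqP => S S2.
have [/forallP all|] := boolP [forall a, a \in c @: edges_in S].
  suff : 2 < #|c @: edges_in S| by rewrite ltnNge S2.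
  apply: (@leq_trans #|[set red; blue; yellow]|).
    by rewrite setUC cardsU1 cards2 !inE.
  by apply: subset_leq_card; apply/subsetP => a _; apply: all.
rewrite negb_forall => /existsP[a aS]; apply: (h S a) => e eS.
by apply: contra aS => /eqP <-; apply: imset_f.
Qed.

(** * The lower bound for a coloring that avoids the patterns *)

Section Forb.
Variable c : coloring n.
Hypothesis cH : c \in Forb n forbidden.

Let redE : {set edge n} := [set e | c e == red].

Lemma forb_pattern t : #|t| = 3 -> triangle_pattern c t \notin forbidden.
Proof. by move=> t3; move: cH; rewrite inE => /forallP /(_ t); rewrite t3. Qed.

Lemma forb_triangle_free : triangle_free redE.
Proof.
move=> t t3; apply/negP => /subsetP tr; case/negP: (forb_pattern t3).
have tc e : e \in edges_in t -> c e = red by move=> /tr; rewrite inE => /eqP.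
apply: forbidden_triangle => //; rewrite triangle_patternE.
  by apply: eq_card0 => e; rewrite !inE; apply/negP => /andP[et]; rewrite tc ?inE.
rewrite leqW // leqn0 cards_eq0; apply/eqP/setP => e; rewrite !inE.
by apply/negP => /andP[et]; rewrite tc ?inE.
Qed.

(** Together with the two red edges to [x], a red edge would give [rrr] and a blue one [rrb]. *)
Lemma forb_red_nbr x : {in edges_in (nbr redE x), forall e, c e = yellow}.
Proof.
move=> e; rewrite inE; have [y [z [yz eE]]] := edge_ends e.
rewrite eE subUset !sub1set !inE => /andP[/adjP[f + fE] /adjP[g + gE]].
rewrite !inE => /eqP fr /eqP gr.
have xy : x != y.
  by apply/negP => /eqP xy; have := valP f; rewrite /= fE xy setUid cards1.
have xz : x != z.
  by apply/negP => /eqP xz; have := valP g; rewrite /= gE xz setUid cards1.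
have [t3 et tE] := edge_not_in3 xy xz eE.
have tr h : h \in edges_in [set x; y; z] -> h != e -> c h = red.
  by move=> /tE ht /ht[]; [rewrite -fE|rewrite -gE] => /val_inj ->.
apply/eqP; apply: contraT => ey; case/negP: (forb_pattern t3).
apply: forbidden_triangle => //; rewrite triangle_patternE.
  apply: eq_card0 => h; rewrite !inE; apply/negP => /andP[ht].
  by have [->|/tr ->] := eqVneq h e; rewrite ?(negPf ey) ?inE.
rewrite -[leqRHS](cards1 e); apply: subset_leq_card; apply/subsetP => h.
rewrite !inE => /andP[ht]; have [//|/tr ->] := eqVneq h e; by rewrite ?inE.
Qed.

Lemma h2_coloring_lower d L : 4 ^ L <= d ->
  d <= h2_coloring c \/ L * n <= 8 * d * h2_coloring c.
Proof.
move=> Ld; have [/existsP[x dx]|] := boolP [exists x, d <= #|nbr redE x|].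
  left; apply: (leq_trans dx); apply: (@h2_coloring_ge _ _ red) => e.
  by move/forb_red_nbr => ->.
rewrite negb_exists => /forallP dn; right.
have deg x : #|nbrs (adj redE) x| <= d by rewrite ltnW // ltnNge dn.
have [W stW] := triangle_free_stable (@adj_sym n redE)
  (triangle_free_adj forb_triangle_free) Ld deg.
rewrite card_ord => /leq_trans; apply; rewrite leq_mul2l; apply/orP; right.
apply: (@h2_coloring_ge _ _ red) => e; have [x [y [xy eE]]] := edge_ends e.
rewrite inE eE subUset !sub1set => /andP[xW yW].
apply/negP => er; move: ((stableP _ _ stW) _ _ xW yW) => /negP; apply.
by apply/adjP; exists e; rewrite ?inE.
Qed.

End Forb.

Lemma h2_eq : h2 n forbidden = n \/
  exists2 c, c \in Forb n forbidden & h2 n forbidden = h2_coloring c.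
Proof.
rewrite /h2; apply: (big_ind (fun m => m = n \/
  exists2 c, c \in Forb n forbidden & m = h2_coloring c)); first by left.
- by move=> a b ha hb; rewrite /minn; case: ifP.
- by move=> c cH; right; exists c.
Qed.

Lemma h2_lower d L : 4 ^ L <= d ->
  d <= h2 n forbidden \/ L * n <= 8 * d * h2 n forbidden.
Proof.
move=> Ld; case: h2_eq => [->|[c cH ->]]; last exact: h2_coloring_lower.
(* When the minimum takes its default value [n], the second alternative follows from
   [L <= 4 ^ L <= d]. *)
right; rewrite leq_mul2r; apply/orP; right.
apply: (@leq_trans d); last exact: leq_pmull.
by apply: leq_trans Ld; apply/ltnW/ltn_expl.
Qed.

Lemma h2_le c : c \in Forb n forbidden -> h2 n forbidden <= h2_coloring c.
Proof. by move=> cH; apply: bigminn_le_cond. Qed.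

End Colorings.

(** * The coloring of a triangle-free graph *)

Section GraphColoring.
Variables (n : nat) (G : {set edge n}).
Hypothesis G_free : triangle_free G.
Implicit Types (S t : {set 'I_n}).

(** The ends of [e] have a common neighbour in [G]; the triple is quantified directly so as to match
    the triangles of [Forb]. *)
Definition closing (e : edge n) :=
  [exists t : {set 'I_n},
    [&& #|t| == 3, e \in edges_in t & edges_in t :\ e \subset G]].

Definition graph_coloring : coloring n :=
  [ffun e => if e \in G then red else if closing e then yellow else blue].

Lemma graph_coloring_red e : (graph_coloring e == red) = (e \in G).
Proof. by rewrite ffunE; case: ifP => // _; case: ifP. Qed.

(** A forbidden triangle has an edge [e] outside [G], which must be blue as there is no yellow. With
    at most one blue edge the other two lie in [G], so [e] is closing and would have been colored
    yellow. *)
Lemma graph_coloring_forb : graph_coloring \in Forb n forbidden.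
Proof.
rewrite inE; apply/forallP => t; apply/implyP => /eqP t3; apply/negP.
move=> /forbidden_triangleP []; rewrite !triangle_patternE.
move=> /eqP; rewrite cards_eq0 => /eqP/setP noY /card_le1_eqP bE.
have /subsetPn[e et eG] := G_free t3.
have eb : graph_coloring e = blue.
  move: (noY e) (graph_coloring_red e); rewrite !inE in et *; rewrite et (negPf eG).
  by case: (graph_coloring e).
move: eb; rewrite ffunE (negPf eG); case: ifPn => // /negP[].
apply/existsP; exists t; rewrite t3 et eqxx /=; apply/subsetP => f.
rewrite in_setD1 => /andP[fe ft]; apply: contraNT fe => fG; apply/eqP.
have blueE h : h \in edges_in t -> h \notin G ->
    h \in [set e0 in edges_in t | graph_coloring e0 == blue].
  move=> ht hG; move: (noY h) (graph_coloring_red h); rewrite !inE in ht *.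
  by rewrite ht (negPf hG) /=; case: (graph_coloring h).
by apply: bE; apply: blueE.
Qed.

Lemma closing_common_nbr e x y : x != y -> val e = [set x; y] -> closing e ->
  exists v, adj G v x && adj G v y.
Proof.
move=> xy eE /existsP[t /and3P[/eqP t3 et /subsetP tG]].
move: et; rewrite inE eE subUset !sub1set => /andP[xt yt].
have /card_gt0P[v] : 0 < #|t :\: [set x; y]|.
  rewrite cardsD (setIidPr _) ?subUset ?sub1set ?xt ?yt // t3 cards2.
  by case: eqP.
rewrite !inE negb_or => /andP[/andP[vx vy] vt]; exists v.
have edgeG z : z \in t -> v != z -> adj G v z.
  move=> zt vz; have vz2 : #|[set v; z]| == 2 by rewrite cards2 vz.
  apply/adjP; exists (Sub [set v; z] vz2) => //; apply: tG.
  rewrite in_setD1 inE subUset !sub1set vt zt !andbT.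
  apply/eqP => /(congr1 val); rewrite eE => /setP /(_ v).
  by rewrite /= !inE eqxx (negPf vx) (negPf vy).
by rewrite !edgeG.
Qed.

(** Two red edges at [x] inside [S] would make the pair of their other ends closing, and that pair
    is not in [G] by triangle-freeness, hence it would be yellow. *)
Lemma yellow_free_matching S :
    {in edges_in S, forall e, graph_coloring e != yellow} ->
  forall x y z, x \in S -> y \in S -> z \in S -> adj G x y -> adj G x z -> y = z.
Proof.
move=> SY x y z xS yS zS /adjP[f fG fE] /adjP[g gG gE]; apply/eqP.
apply: contraT => yz.
have yz2 : #|[set y; z]| == 2 by rewrite cards2 yz.
pose e : edge n := Sub [set y; z] yz2.
have eS : e \in edges_in S by rewrite inE subUset !sub1set yS.
have xy : x != y.
  by apply/negP => /eqP xy; have := valP f; rewrite /= fE xy setUid cards1.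
have xz : x != z.
  by apply/negP => /eqP xz; have := valP g; rewrite /= gE xz setUid cards1.
have [t3 et tE] := edge_not_in3 xy xz (erefl : val e = [set y; z]).
have tG : edges_in [set x; y; z] :\ e \subset G.
  apply/subsetP => h; rewrite in_setD1 => /andP[he /tE /(_ he)].
  by case; rewrite -?fE -?gE => /val_inj ->.
have eG : e \notin G.
  apply/negP => eG; case/negP: (G_free t3); apply/subsetP => h ht.
  have [->//|he] := eqVneq h e.
  by move/subsetP: tG; apply; rewrite in_setD1 he.
have := SY _ eS; rewrite ffunE (negPf eG) (_ : closing e) //.
by apply/existsP; exists [set x; y; z]; rewrite t3 et tG eqxx.
Qed.

(* Keep the vertices that are not the larger end of a red edge inside [S]. *)
Lemma matching_stable_half S :
  (forall x y z, x \in S -> y \in S -> z \in S -> adj G x y -> adj G x z -> y = z) ->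
  exists2 W : {set 'I_n}, [disjoint G & edges_in W] & #|S| <= 2 * #|W|.
Proof.
move=> Sm.
pose W := [set x in S | [forall y in S, adj G x y ==> (x < y)]].
have Wst : [disjoint G & edges_in W].
  rewrite disjoint_subset; apply/subsetP => e eG; apply/negP => /=.
  have [x [y [xy eE]]] := edge_ends e.
  rewrite inE eE subUset !sub1set !inE.
  move=> /andP[/andP[xS /forall_inP xW] /andP[yS /forall_inP yW]].
  have a1 : adj G x y by apply/adjP; exists e.
  have a2 : adj G y x by rewrite adj_sym.
  have := ltn_trans (implyP (xW _ yS) a1) (implyP (yW _ xS) a2).
  by rewrite ltnn.
(* [f] sends a discarded vertex to its partner in the matching, which is kept; this is injective.
   The default is never reached on [S :\: W]. *)
exists W => //; pose f x := odflt x [pick y in S | adj G x y].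
have fP x : x \in S :\: W -> f x \in W /\ adj G x (f x).
  rewrite !inE => /andP[xW xS]; move: xW; rewrite xS /= negb_forall_in.
  move=> /exists_inP[y yS]; rewrite negb_imply -leqNgt => /andP[xy yx].
  have -> : f x = y.
    rewrite /f; case: pickP => [z /andP[zS xz]|/(_ y)]; last by rewrite yS xy.
    exact: (Sm x).
  split => //; rewrite yS; apply/forall_inP => z zS; apply/implyP => yz.
  have -> : z = x by apply: (Sm y) => //; rewrite adj_sym.
  rewrite ltn_neqAle yx andbT; apply/negP => /eqP/val_inj yx'.
  by move: xy; rewrite yx' (negPf (adj_irr _ _)).
have WS : W \subset S by apply/subsetP => x; rewrite inE => /andP[].
rewrite mul2n -addnn -(cardsID W S) (setIidPr WS) leq_add2l.
rewrite -(card_in_imset (f := f)).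
  by apply: subset_leq_card; apply/subsetP => _ /imsetP[x /fP[? _] ->].
move=> x y xS yS fxy; have [fx ax] := fP _ xS; have [_ ay] := fP _ yS.
move: xS yS; rewrite !inE => /andP[_ xS] /andP[_ yS].
apply: (Sm (f x)) => //; first exact: (subsetP WS).
  by rewrite adj_sym.
by rewrite adj_sym fxy.
Qed.

End GraphColoring.

(** * The upper bound from a good random graph *)

Lemma subset_of_card (T : finType) (S : {set T}) k : k <= #|S| ->
  exists2 W : {set T}, W \subset S & #|W| = k.
Proof.
move=> kS; have : 0 < #|[set A : {set T} | A \subset S & #|A| == k]|.
  by rewrite cards_draws bin_gt0.
by case/card_gt0P => W; rewrite inE => /andP[WS /eqP Wk]; exists W.
Qed.

Lemma edges_inS n (S W : {set 'I_n}) : W \subset S -> edges_in W \subset edges_in S.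
Proof.
by move=> WS; apply/subsetP => e; rewrite !inE => /subset_trans; apply.
Qed.

(* Every pair inside [S] is an edge or lies in a common neighbourhood, so
   [|S| ^ 2] is at most [\sum_v |N(v) :&: S| ^ 2] up to lower order terms. *)
Lemma blue_free_card n (X G : {set edge n}) (S : {set 'I_n}) (D T M : nat) :
  G \subset X ->
  {in edges_in S, forall e, graph_coloring G e != blue} ->
  (forall x, #|nbr X x| <= D) ->
  (forall B : {set 'I_n}, T * #|B| <= degree_sum X S B -> degree_sum X S B <= M) ->
  #|S| * #|S| <= #|S| + #|S| * D + n * (T * T) + D * M.
Proof.
move=> GX SB Xd XB.
have adjGX x y : adj G x y -> adj X x y.
  by move=> /adjP[e eG eE]; apply/adjP; exists e => //; apply: (subsetP GX).
apply: (@leq_trans (\sum_(x in S) \sum_(y in S)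
   ((x == y) + (adj X x y) + \sum_v (adj X v x && adj X v y)))).
  rewrite -sum_nat_const; apply: leq_sum => x xS.
  rewrite -sum1_card; apply: leq_sum => y yS.
  have [//|xy] := eqVneq x y.
  have xy2 : #|[set x; y]| == 2 by rewrite cards2 xy.
  pose e : edge n := Sub [set x; y] xy2.
  have eS : e \in edges_in S by rewrite inE subUset !sub1set xS.
  have := SB _ eS; rewrite ffunE; case: ifP => [eG|_].
    by move=> _; rewrite (adjGX x y) //; apply/adjP; exists e.
  case: ifP => // /(closing_common_nbr xy (erefl : val e = _))[v /andP[vx vy]] _.
  by rewrite (bigD1 v) //= (adjGX _ _ vx) (adjGX _ _ vy) add1n addnS.
under eq_bigr do rewrite !big_split /=.
rewrite !big_split /= -!addnA; apply: leq_add.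
  rewrite -[leqRHS]sum1_card; apply: leq_sum => x xS.
  rewrite (bigD1 x) //= eqxx big1 ?addn0 // => y /andP[_ /negPf].
  by rewrite eq_sym => ->.
have cardE x : \sum_(y in S) (adj X x y : nat) = #|nbr X x :&: S|.
  rewrite -sum1_card big_mkcond /= [RHS]big_mkcond; apply: eq_bigr => y _.
  by rewrite !inE; case: (y \in S); rewrite ?andbF ?andbT //; case: adj.
apply: leq_add.
  rewrite -sum_nat_const; apply: leq_sum => x _; rewrite cardE.
  by apply: leq_trans (Xd x); apply: subset_leq_card; apply: subsetIl.
have -> : \sum_(x in S) \sum_(y in S) \sum_v (adj X v x && adj X v y : nat) =
          \sum_v #|nbr X v :&: S| * #|nbr X v :&: S|.
  under eq_bigr do rewrite exchange_big /=.
  rewrite exchange_big /=; apply: eq_bigr => v _.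
  rewrite -[X in X * _]cardE big_distrl /=; apply: eq_bigr => x _.
  by rewrite -cardE big_distrr /=; apply: eq_bigr => y _; case: adj; case: adj.
(* A light vertex contributes at most [T * T]. The heavy vertices form a set [B] to which the
   hypothesis on degree sums applies, with one factor of each square bounded by [D]. *)
rewrite (bigID (fun v => T <= #|nbr X v :&: S|)) /= addnC; apply: leq_add.
  apply: (@leq_trans (\sum_(v : 'I_n) T * T)).
    rewrite big_mkcond /=; apply: leq_sum => v _; case: ifP => //.
    by rewrite -ltnNge => /ltnW h; apply: leq_mul.
  by rewrite sum_nat_const card_ord.
pose B := [set v | T <= #|nbr X v :&: S|].
have hB : degree_sum X S B <= M.
  apply: XB; rewrite mulnC -sum_nat_const.
  by apply: leq_sum => v; rewrite inE.
apply: (@leq_trans (D * degree_sum X S B)); last by rewrite leq_mul2l hB orbT.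
rewrite /degree_sum big_distrr /= (eq_bigl (fun v => v \in B)); last first.
  by move=> v; rewrite inE.
apply: leq_sum => v _; rewrite leq_mul2r; apply/orP; right.
by apply: leq_trans (Xd v); apply: subset_leq_card; apply: subsetIl.
Qed.

(** With [K = a * q * l], the light and the heavy terms are each at most a quarter of [K * K], and
    [K + K * q] is at most [K * K / 32]. *)
Lemma red_yellow_arith a q l n M :
  64 <= a -> 0 < l -> 0 < q -> 4 * (a * a) * n <= q * q ->
  M = a * q * l ->
  M + M * q + n * (a * (a * l) * (a * (a * l))) + q * (16 * M * l) < M * M.
Proof.
move=> a64 l0 q0 nq ->.
set K := a * q * l.
have K0 : 0 < K by rewrite !muln_gt0 l0 q0 !andbT (leq_trans _ a64).
have e1 : 4 * (n * (a * (a * l) * (a * (a * l)))) <= K * K.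
  have : 4 * (a * a) * n * (a * a * (l * l)) <= q * q * (a * a * (l * l)).
    by rewrite leq_mul2r nq orbT.
  by rewrite /K; lia.
have e2 : 64 * (q * (K * l)) <= K * K.
  have : K * (64 * (q * l)) <= K * (a * (q * l)) by rewrite leq_mul2l leq_mul2r a64 !orbT.
  rewrite {4}/K; lia.
have e3 : K * q <= q * (K * l) by rewrite mulnC leq_mul2l leq_pmulr // orbT.
have e4 : K <= K * q by rewrite leq_pmulr.
have K2 : 0 < K * K by rewrite muln_gt0 K0.
have -> : q * (16 * K * l) = 16 * (q * (K * l)) by rewrite -mulnA mulnCA.
by move: e1 e2 e3 e4 K2; move: (n * _) (q * (K * l)) (K * K) (K * q); lia.
Qed.

Lemma h2_upper (R : realType) (n q l : nat) :
  0 < l -> 2 * l + 4 <= q -> 4 * (64 * 64) * n <= q * q ->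
  (n%:R <= expR l%:R :> R)%R ->
  h2 n forbidden <= 2 * (64 * q * l).
Proof.
move=> l0 ql nq nl.
have nq' : 64 * n <= q ^ 2.
  by apply: leq_trans nq; rewrite leq_mul2r; apply/orP; right.
have [X [Xd XG XB]] := exists_good_graph l0 ql nq' nl.
have Pf := @prune_triangle_free _ X.
apply: leq_trans (h2_le (graph_coloring_forb Pf)) _.
set K := 64 * q * l in XG XB *.
(* The random graph is controlled only on sets of size exactly [K], so a larger set is first cut
   down to that size. *)
have stK (W : {set 'I_n}) : [disjoint prune X & edges_in W] -> #|W| <= K.
  move=> dW; rewrite leqNgt; apply/negP => /ltnW/subset_of_card[V VW VK].
  case/negP: (XG _ VK); apply: disjointWr dW; exact: edges_inS.
apply: h2_coloring_le => S [] Sa.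
- apply: (@leq_trans K); last exact: leq_pmull.
  apply: stK; rewrite disjoint_sym disjoint_subset; apply/subsetP => e /Sa.
  by rewrite graph_coloring_red.
- apply: (@leq_trans K); last exact: leq_pmull.
  rewrite leqNgt; apply/negP => /ltnW/subset_of_card[V VS VK].
  have Va : {in edges_in V, forall e, graph_coloring (prune X) e != blue}.
    by move=> e eV; apply: Sa; apply: (subsetP (edges_inS VS)).
  have := blue_free_card (D := q) (T := 64 * (64 * l)) (M := 16 * K * l)
    (prune_sub X) Va _ _; rewrite VK => h.
  have {h} : K * K <=
      K + K * q + n * (64 * (64 * l) * (64 * (64 * l))) + q * (16 * K * l).
    by apply: h => [x|B hB]; [exact: ltnW|exact/ltnW/XB].
  by rewrite leqNgt (@red_yellow_arith 64 q l n) // (leq_trans _ ql) // addn4.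
- have [W /stK WK SW] := matching_stable_half (yellow_free_matching Pf Sa).
  by apply: leq_trans SW _; rewrite leq_mul2l WK orbT.
Qed.

(** * Asymptotics *)

Lemma nat_sqrt m : exists2 s, s * s <= m & m < s.+1 * s.+1.
Proof.
elim: m => [|m [s sm ms]]; first by exists 0.
have [h|h] := ltnP m.+1 (s.+1 * s.+1); first by exists s => //; apply: leqW.
by exists s.+1 => //; nia.
Qed.

Lemma sqr_le_exp2 m : m * m <= 4 * 2 ^ m.
Proof.
elim: m => // m IH; have : m < 2 ^ m by exact: ltn_expl.
rewrite expnS; move: (2 ^ m) IH => e; nia.
Qed.

(** Here [d] is the integer square root of [n * l], and [L = l %/ 4] is admissible because
    [(4 ^ L) ^ 2 = 16 ^ L <= 2 ^ l]. The assumption [4 <= l] ensures [l <= 8 * L] despite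
    rounding. *)
Lemma h2_lower_sqrt n l d : 4 <= l -> 2 ^ l <= n ->
  d * d <= n * l -> n * l < d.+1 * d.+1 -> 0 < d /\ d <= 64 * h2 n forbidden.
Proof.
move=> l4 ln dn nd.
have nl : 2 ^ l <= n * l.
  by apply: (leq_trans ln); rewrite leq_pmulr // (leq_trans _ l4).
have Ld : 4 ^ (l %/ 4) <= d.
  rewrite leqNgt; apply/negP => dL.
  have : 4 ^ (l %/ 4) * 4 ^ (l %/ 4) <= n * l.
    apply: leq_trans nl; rewrite -expnMn (_ : 4 * 4 = 2 ^ 4) // -expnM mulnC.
    by rewrite leq_exp2l // leq_divM.
  by rewrite leqNgt (leq_trans nd) // leq_mul.
have d0 : 0 < d by apply: leq_trans Ld; rewrite expn_gt0.
split=> //; case: (h2_lower n Ld) => [h|h].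
  by apply: (leq_trans h); rewrite leq_pmull.
have l8 : l <= 8 * (l %/ 4) by lia.
have : d * d <= d * (64 * h2 n forbidden).
  apply: (leq_trans dn); apply: (@leq_trans (8 * (l %/ 4 * n))).
    by rewrite mulnA mulnC leq_mul2r l8 orbT.
  move: h; move: (l %/ 4 * n) (h2 n forbidden) => A h; lia.
by rewrite leq_pmul2l.
Qed.

Lemma h2_upper_sqrt (R : realType) n l s : 2 ^ l <= n -> n < 2 ^ l.+1 ->
  s * s <= n -> n < s.+1 * s.+1 -> h2 n forbidden <= 64 * (256 * (s.+1 * l.+1)).
Proof.
move=> ln nl sn ns.
have := sqr_le_exp2 l => l2.
(* Logarithm against square root: this gives the requirement [2 * l + 4 <= q] for [q = 128 * s.+1],
   with [l.+1] in the role of [l]. The factor 128 is chosen since [128 * 128 = 4 * (64 * 64)]. *)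
have ls : l < 2 * s.+1.
  rewrite ltnNge; apply/negP => sl.
  have : 2 * s.+1 * (2 * s.+1) <= l * l by apply: leq_mul.
  move: l2 ln ns; move: (2 ^ l) (l * l) => A B; nia.
have := @h2_upper R n (128 * s.+1) l.+1 isT _ _ _.
set h := h2 n forbidden; set u := s.+1 * l.+1.
have -> : 2 * (64 * (128 * s.+1) * l.+1) = 64 * (256 * u) by rewrite /u; lia.
apply.
- lia.
- rewrite mulnACA [X in X * _ <= _](_ : 4 * (64 * 64) = 128 * 128) //.
  by rewrite leq_mul2l ltnW ?orbT.
apply: (@le_trans _ _ ((2 ^ l.+1)%:R)%R); first by rewrite ler_nat ltnW.
rewrite natrX -[X in (_ <= expR X)%R]mulr1 expRM_natl.
apply: lerXn2r; rewrite ?nnegrE ?expR_ge0 //.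
by apply: le_trans (expR_ge1Dx _).
Qed.

Section Asymptotics.
Variable R : realType.
Local Open Scope ring_scope.

Lemma ln2_gt0 : 0 < ln 2 :> R.
Proof. by rewrite ln_gt0 // ltr1n. Qed.

Lemma log2_exp2 l : log2 ((2 ^ l)%:R : R) = l%:R.
Proof.
by rewrite /log2 natrX lnXn // -[ln 2 *+ l]mulr_natl mulfK // gt_eqF // ln2_gt0.
Qed.

Lemma ler_log2 (x y : R) : 0 < x -> x <= y -> log2 x <= log2 y.
Proof.
move=> x0 xy; rewrite /log2 ler_wpM2r ?invr_ge0 ?(ltW ln2_gt0) //.
by rewrite ler_ln ?posrE // (lt_le_trans x0).
Qed.

Lemma h2_lower_real n : (16 <= n)%N ->
  Num.sqrt (n%:R * log2 n%:R : R) <= 192 * (h2 n forbidden)%:R.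
Proof.
move=> n16; have n0 : (0 < n)%N by apply: leq_trans n16.
pose l := trunc_log 2 n.
have /andP[ln nl] := trunc_log_bounds (isT : (1 < 2)%N) n0.
have l4 : (4 <= l)%N by apply: trunc_log_max.
have [d dn nd] := nat_sqrt (n * l).
have [d0 dh] := h2_lower_sqrt l4 ln dn nd.
(* The factor 3 absorbs both roundings: [n * l.+1 <= 2 * (n * l)] and [d.+1 <= 2 * d] give at most
   [8 * d ^ 2]. *)
apply: (@le_trans _ _ (3 * d%:R)); last first.
  by rewrite -!natrM ler_nat -[192%N]/(3 * 64)%N -mulnA leq_mul2l dh orbT.
have d3 : 0 <= 3 * d%:R :> R by rewrite mulr_ge0.
rewrite -[leRHS](ger0_norm d3) -sqrtr_sqr; apply: ler_wsqrtr.
apply: (@le_trans _ _ (n%:R * l.+1%:R)).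
  rewrite ler_wpM2l // -[l.+1%:R]log2_exp2; apply: ler_log2; first by rewrite ltr0n.
  by rewrite ler_nat ltnW.
rewrite -!natrM -natrX ler_nat expnMn; nia.
Qed.

Lemma h2_upper_real n : (2 <= n)%N ->
  (h2 n forbidden)%:R <=
    64 * (256 * 4) * (Num.sqrt n%:R * log2 n%:R `^ (3 / 2)) :> R.
Proof.
move=> n2; have n0 : (0 < n)%N by apply: leq_trans n2.
pose l := trunc_log 2 n.
have /andP[ln nl] := trunc_log_bounds (isT : (1 < 2)%N) n0.
have l1 : (1 <= l)%N by apply: trunc_log_max.
have [s sn ns] := nat_sqrt n.
have s0 : (0 < s)%N by case: s ns {sn} => //; rewrite ltnNge n0.
have ss : s.+1%:R <= 2 * Num.sqrt n%:R :> R.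
  apply: (@le_trans _ _ (2 * s%:R)); first by rewrite -natrM ler_nat; lia.
  rewrite ler_wpM2l // -[leLHS](ger0_norm (ler0n _ _)) -sqrtr_sqr.
  by apply: ler_wsqrtr; rewrite -natrX ler_nat expnS expn1.
have lL : l%:R <= log2 n%:R :> R.
  by rewrite -[l%:R]log2_exp2; apply: ler_log2; rewrite ?ltr0n ?expn_gt0 // ler_nat.
have L1 : 1 <= log2 n%:R :> R by apply: le_trans lL; rewrite ler1n.
have ll : l.+1%:R <= 2 * log2 n%:R `^ (3 / 2) :> R.
  apply: (@le_trans _ _ (2 * l%:R)); first by rewrite -natrM ler_nat; lia.
  (* Only here is the first power of the logarithm weakened to the exponent 3/2, which is allowed as
     [log2 n%:R] is at least 1. *)
  rewrite ler_wpM2l //; apply: (le_trans lL).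
  rewrite -[leLHS]powRr1; last by apply: le_trans L1.
  by apply: ler_powR => //; lra.
apply: (@le_trans _ _ (64 * (256 * (s.+1%:R * l.+1%:R)))).
  by rewrite -!natrM ler_nat; apply: (h2_upper_sqrt R ln nl sn ns).
have : s.+1%:R * l.+1%:R <= 2 * Num.sqrt n%:R * (2 * log2 n%:R `^ (3 / 2)) :> R.
  by apply: ler_pM.
move: (s.+1%:R * l.+1%:R) (Num.sqrt _) (_ `^ _) => a b c; lra.
Qed.

End Asymptotics.


(* Imported only here because [classical_sets] shadows names of [finset]. *)
From mathcomp Require Import boolp classical_sets reals topology normedtype.
From mathcomp Require Import landau exp.
Import GRing.Theory Num.Theory numFieldNormedType.Exports.

Local Open Scope classical_set_scope.
Local Open Scope ring_scope.

Theorem lemma2p5 (R : realType) :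
  let H : {fset pattern} := [fset rrr; rrb]%fset in
  (fun n : nat => (h2 n H)%:R : R) =Omega_\oo
    (fun n : nat => Num.sqrt (n%:R * log2 n%:R : R)) /\
  (fun n : nat => (h2 n H)%:R : R) =O_\oo
    (fun n : nat => Num.sqrt (n%:R : R) * log2 n%:R `^ (3 / 2)).
Proof.
split.
  rewrite eqOmegaE eqOmegaO; apply/eqO_exP; exists 192 => //; near=> n.
  have n16 : (16 <= n)%N by near: n; apply: nbhs_infty_ge.
  by rewrite !ger0_norm ?sqrtr_ge0 //; apply: (h2_lower_real R n16).
apply/eqO_exP; exists (64 * (256 * 4)) ; first by rewrite !mulr_gt0.
near=> n.
have n2 : (2 <= n)%N by near: n; apply: nbhs_infty_ge.
rewrite !ger0_norm ?mulr_ge0 ?sqrtr_ge0 ?powR_ge0 //; exact: (h2_upper_real R n2).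
Unshelve. all: by end_near.
Qed.
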